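(* Let $A\in\mathbb{R}^{m\times n}$ be row-normalized ($\|a_j\|=1$ for every row $a_j$, $j\in[m]$), over-determined ($m>n$) and full-rank. Let $b_t\in\mathbb{R}^m$, let $x^\ast\in\mathbb{R}^n$ be a solution to $Ax=b_t$, and let $b=b_t+b_\varepsilon$ where $b_\varepsilon\in\mathbb{R}^m$ satisfies $\|b_\varepsilon\|_0\le\beta m$. Here $\beta\ge 0$, $q_0$ and $q_1$ are such that $\beta m$, $q_0m$, $q_1m$ are integers. Suppose $\beta<q_0<q_1<1-\beta$, $q_1-q_0>\beta$, and $$\frac{q_1}{q_1-q_0-\beta}\left(\frac{2\sqrt{\beta}}{\sqrt{1-q_1-\beta}}+\frac{\beta}{1-q_1-\beta}\right)<\frac{1}{\sigma_{\max}^2(A)}\left(\sigma_{q_1-\beta,\min}^2(A)+\frac{\sigma_{q_0-\beta,\min}^2(A)}{q_0m}\right).$$ Let $x_0\in\mathbb{R}^n$ satisfy $\langle x_0,a_i\rangle=b_i$ for some $i\in[m]$, and let $(x_k)_{k\ge0}$ be the iterates of the double quantile-based randomized Kaczmarz method (dqRK) with inputs $A,b,q_0,q_1,x_0$. Then for every $k\ge 0$, $$\mathbb{E}\|x_k-x^\ast\|^2\le(1-C)^k\|x_0-x^\ast\|^2,$$ where $$C=(q_1-q_0-\beta)\left(\frac{\sigma_{q_1-\beta,\min}^2(A)}{(q_1-q_0)q_1m}+\frac{\sigma_{q_0-\beta,\min}^2(A)}{(q_1-q_0)q_0q_1m^2}\right)-\frac{\sigma_{\max}^2(A)}{(q_1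-q_0)m}\left(\frac{2\sqrt{\beta}}{\sqrt{1-q_1-\beta}}+\frac{\beta}{1-q_1-\beta}\right).$$
   Context: Notation: $[m]=\{1,\dots,m\}$; $\|\cdot\|$ is the Euclidean norm, $\|\cdot\|_F$ the Frobenius norm, and $\|x\|_0$ the number of nonzero entries of $x$. $\sigma_{\max}(A)$ is the largest singular value of $A$. For $S\subseteq[m]$, $A_S\in\mathbb{R}^{|S|\times n}$ is the submatrix of $A$ formed by the rows indexed by $S$. For $\alpha$ with $\alpha m$ an integer, $$\sigma_{\alpha,\min}(A)=\min_{S\subseteq[m],\,|S|=\alpha m}\ \inf_{\|x\|=1}\|A_Sx\|.$$ Quantile convention: for a finite family of real numbers $(s_i)_{i\in I}$ with $I\subset\mathbb{N}$ and $q|I|$ an integer, the $q$-th quantile is the $(q|I|)$-th smallest value. The index set ''$\{i: s_i\le q\text{-th quantile}\}$'' is taken to consist of exactly $q|I|$ indices, namely the first $q|I|$ indices when the indices are ordered by nondecreasing value $s_i$, ties being broken by index order; ''$\{i:s_i>q\text{-th quantile}\}$'' denotes its complement in $I$. Algorithm dqRK (inputs $A,b,q_0,q_1,x_0$): for $k=0,1,2,\dots$, given $x_k$, 1. let $Q_0$ and $Q_1$ be the $q_0$-th and $q_1$-th quantiles of the family $\left(\frac{|\langle x_k,a_j\rangle-b_j|}{\|a_j\|}\right)_{j\in[m]}$; 2. let $B=\left\{j\in[m]:Q_0<\frac{|\langle x_k,a_j\rangle-b_j|}{\|a_j\|}\le Q_1\right\}$ (with the convention above, so $|B|=(q_1-q_0)m$);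 3. select $i\in B$ at random with probability $\frac{\|a_i\|^2}{\|A_B\|_F^2}$ (uniformly when $A$ is row-normalized; conditionally on $x_k$, independently of the past); 4. set $x_{k+1}=x_k+\frac{b_i-\langle x_k,a_i\rangle}{\|a_i\|^2}a_i$. The expectation is over all the random choices of the algorithm; $A,b_t,b_\varepsilon$ are fixed. *)

(* Defs.v *)
From HB Require Import structures.
From mathcomp Require Import all_boot all_order all_algebra.
From mathcomp Require Import all_classical all_reals all_analysis.

Set Implicit Arguments.
Unset Strict Implicit.
Unset Printing Implicit Defensive.

Import Order.TTheory GRing.Theory Num.Theory.
Import numFieldNormedType.Exports.

Local Open Scope classical_set_scope.
Local Open Scope ring_scope.

(* The Frobenius norm, which on row and column vectors is the Euclidean norm.
   The library's norm `|A| on matrices is the max-norm, hence this definition. *)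
Definition fnorm (R : realType) (p q : nat) (A : 'M[R]_(p, q)) : R :=
  Num.sqrt (\sum_i \sum_j A i j ^+ 2).

Definition dot (R : realType) (n : nat) (u v : 'cV[R]_n) : R :=
  \sum_i u i 0 * v i 0.

Definition norm0 (R : realType) (m : nat) (x : 'cV[R]_m) : nat :=
  #|[pred i | x i 0 != 0]|.

(* The i-th row a_i of A, as an element of R^n. *)
Definition arow (R : realType) (m n : nat) (A : 'M[R]_(m, n)) (i : 'I_m) :
  'cV[R]_n := (row i A)^T.

Definition rows_in (R : realType) (m n : nat) (A : 'M[R]_(m, n))
  (S : {set 'I_m}) : 'M[R]_(#|S|, n) :=
  rowsub (fun i : 'I_#|S| => enum_val i) A.

(* The singular values of A are the square roots of the eigenvalues of A^T A;
   there are finitely many of them, so the supremum is a maximum for n > 0. *)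
Definition sigma_max (R : realType) (m n : nat) (A : 'M[R]_(m, n)) : R :=
  sup [set Num.sqrt l | l in [set l : R | eigenvalue (A^T *m A) l]].

(* When alpha * m is an integer in {0, ..., m}, the outer infimum is over a
   nonempty finite family, so it is a minimum. *)
Definition sigma_min (R : realType) (m n : nat) (alpha : R)
  (A : 'M[R]_(m, n)) : R :=
  inf [set inf [set fnorm (rows_in A S *m x) | x in
                  [set x : 'cV[R]_n | fnorm x = 1]]
      | S in [set S : {set 'I_m} | #|S|%:R = alpha * m%:R]].

(* The indices i with s i at most the q-th quantile of s, for q * m a natural
   number: the first q * m indices in nondecreasing order of s. As sort is
   stable and enum 'I_m is increasing, ties are broken by index order. *)
Definition low_quantile (R : realType) (m : nat) (q : R) (s : 'I_m -> R) :
  {set 'I_m} :=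
  finset (mem (take (Num.truncn (q * m%:R))
                    (sort (fun i j => s i <= s j) (enum 'I_m)))).

Section DoubleQuantileRK.
Context (R : realType) (m n : nat) (A : 'M[R]_(m, n)) (b : 'cV[R]_m).
Context (q0 q1 : R).

Definition residual (x : 'cV[R]_n) (j : 'I_m) : R :=
  `|dot x (arow A j) - b j 0| / fnorm (arow A j).

Definition dqRK_block (x : 'cV[R]_n) : {set 'I_m} :=
  (low_quantile q1 (residual x) :\: low_quantile q0 (residual x))%SET.

Definition dqRK_prob (x : 'cV[R]_n) (i : 'I_m) : R :=
  if i \in dqRK_block x
  then fnorm (arow A i) ^+ 2 / fnorm (rows_in A (dqRK_block x)) ^+ 2
  else 0.

Definition kaczmarz_step (x : 'cV[R]_n) (i : 'I_m) : 'cV[R]_n :=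
  x + ((b i 0 - dot x (arow A i)) / fnorm (arow A i) ^+ 2) *: arow A i.

(* A run of the algorithm on a probability space: i k is the random index
   selected at step k and x k is the k-th iterate. As x0 is fixed, the past
   before step k is the tuple (i 0, ..., i (k-1)), which determines x k; the
   last field says that, conditionally on the past observed at w, index j is
   selected with probability dqRK_prob (x k w) j. The conditional probability
   is written in product form, which imposes nothing on null histories. *)
Record is_dqRK (x0 : 'cV[R]_n) (d : measure_display) (T : measurableType d)
    (P : probability T R) (i : nat -> T -> 'I_m) (x : nat -> T -> 'cV[R]_n) :
    Prop := IsDqRK {
  dqRK_measurable : forall k j, measurable (i k @^-1` [set j]);
  dqRK_init : forall w, x 0%N w = x0;
  dqRK_next : forall k w, x k.+1 w = kaczmarz_step (x k w) (i k w);
  dqRK_select : forall k w j,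
    let past := [set v | forall l, (l < k)%N -> i l v = i l w] in
    P (past `&` i k @^-1` [set j]) = (P past * (dqRK_prob (x k w) j)%:E)%E
}.

End DoubleQuantileRK.

(* Main.v *)
Require Import Defs.
From HB Require Import structures.
From mathcomp Require Import all_boot all_order all_algebra.
From mathcomp Require Import all_classical all_reals all_analysis.
From mathcomp Require Import measurable_realfun ring lra.

Set Implicit Arguments.
Unset Strict Implicit.
Unset Printing Implicit Defensive.

Import Order.TTheory GRing.Theory Num.Theory.
Import numFieldNormedType.Exports.

Local Open Scope classical_set_scope.
Local Open Scope ring_scope.

(* Let e = x_k - xs, let L0 and L1 be the index sets below the two quantiles,
   B = L1 \ L0, and G the set of uncorrupted equations, whose residuals are the
   |<e, a_j>|. Projecting onto a row of G :&: B gains <e, a_j>^2. The residuals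
   in B dominate those in L0, and one residual in L0 vanishes because x_k solves
   an equation exactly; an averaging argument then bounds the total gain below
   by the two sigma_min terms. Projecting onto a corrupted row of B changes
   |e|^2 by 2 rho <e, a_j> + rho^2, where rho^2 is at most
   sigma_max^2 |e|^2 / ((1 - q1 - beta) m), as at least (1 - q1 - beta) m
   uncorrupted residuals lie above the upper quantile. This gives a one-step
   contraction in conditional expectation, iterated over the finitely many
   histories of length k. *)

(** * Euclidean norm, inner product and Cauchy-Schwarz *)

Lemma fnorm_sqr (R : realType) p q (A : 'M[R]_(p, q)) :
  fnorm A ^+ 2 = \sum_i \sum_j A i j ^+ 2.
Proof.
rewrite sqr_sqrtr// sumr_ge0// => i _; rewrite sumr_ge0// => j _.
exact: sqr_ge0.
Qed.

Section Dot.
Context (R : realType) (n : nat).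
Implicit Types u v w : 'cV[R]_n.

Lemma dotC u v : dot u v = dot v u.
Proof. by apply: eq_bigr => i _; rewrite mulrC. Qed.

Lemma dotDl u v w : dot (u + v) w = dot u w + dot v w.
Proof. by rewrite -big_split; apply: eq_bigr => i _; rewrite !mxE mulrDl. Qed.

Lemma dotDr u v w : dot u (v + w) = dot u v + dot u w.
Proof. by rewrite dotC dotDl !(dotC u). Qed.

Lemma dotZl c u v : dot (c *: u) v = c * dot u v.
Proof. by rewrite mulr_sumr; apply: eq_bigr => i _; rewrite !mxE mulrA. Qed.

Lemma dotZr c u v : dot u (c *: v) = c * dot u v.
Proof. by rewrite dotC dotZl dotC. Qed.

Lemma dot_fnorm u : dot u u = fnorm u ^+ 2.
Proof. by rewrite fnorm_sqr; apply: eq_bigr => i _; rewrite big_ord1 expr2. Qed.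

Lemma fnorm_eq0 u : (fnorm u == 0) = (u == 0).
Proof.
rewrite -sqrf_eq0 -dot_fnorm psumr_eq0 => [|i _]; last by rewrite -expr2 sqr_ge0.
apply/allP/eqP => [u0|-> i _]; last by rewrite mxE mulr0 eqxx.
apply/matrixP => i j; rewrite ord1 mxE; apply/eqP.
by have /implyP/(_ isT) := u0 i (mem_index_enum i); rewrite mulf_eq0 orbb.
Qed.

Lemma fnorm0 : fnorm (0 : 'cV[R]_n) = 0.
Proof. by apply/eqP; rewrite fnorm_eq0. Qed.

Lemma fnormZ c u : fnorm (c *: u) ^+ 2 = c ^+ 2 * fnorm u ^+ 2.
Proof. by rewrite -!dot_fnorm dotZl dotZr mulrA. Qed.

Lemma fnorm_normalize u : u != 0 -> fnorm ((fnorm u)^-1 *: u) = 1.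
Proof.
move=> u0; apply/eqP; rewrite -(@eqrXn2 _ 2) ?sqrtr_ge0 ?ler01// fnormZ expr1n.
by rewrite -exprMn mulVf ?expr1n// fnorm_eq0.
Qed.

Lemma fnorm_sqr_addZ u c v :
  fnorm (u + c *: v) ^+ 2 = fnorm u ^+ 2 + 2 * c * dot u v + c ^+ 2 * fnorm v ^+ 2.
Proof. rewrite -!dot_fnorm !(dotDl, dotDr, dotZl, dotZr) (dotC v u); ring. Qed.

Lemma dot_trmx m (M : 'M[R]_(m, n)) (u : 'cV[R]_m) v : dot u (M *m v) = dot (M^T *m u) v.
Proof.
have dotE p (a b : 'cV[R]_p) : dot a b = (a^T *m b) 0 0.
  by rewrite mxE; apply: eq_bigr => i _; rewrite mxE.
by rewrite !dotE trmx_mul trmxK mulmxA.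
Qed.

(** The quadratic polynomial [t |-> dot (u + t v) (N (u + t v))] is nonnegative, which bounds its
    discriminant. It serves for the identity and for the form [sup rayleigh - A^T A]. *)
Lemma CauchySchwarz_psd (N : 'M[R]_n) u v : N^T = N ->
    (forall y, 0 <= dot y (N *m y)) ->
  dot u (N *m v) ^+ 2 <= dot u (N *m u) * dot v (N *m v).
Proof.
move=> Nsym Npsd.
have quad t : 0 <= dot u (N *m u) + 2 * t * dot u (N *m v) + t ^+ 2 * dot v (N *m v).
  have := Npsd (u + t *: v).
  rewrite mulmxDr -scalemxAr !(dotDl, dotDr, dotZl, dotZr).
  rewrite [dot v (N *m u)]dot_trmx Nsym (dotC (N *m v)).
  by lra.
move: (Npsd u) (Npsd v) quad.
set a := dot u (N *m u); set b := dot u _; set c := dot v _ => a0 c0 quad.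
have [c_eq0|c_neq0] := eqVneq c 0.
  rewrite c_eq0 in quad *; have [->|b0] := eqVneq b 0; first by nra.
  (* With [c = 0] the polynomial is affine in [t]; if its slope [2 b] were nonzero, this [t] would
     give it the value [-1]. *)
  have := quad (- (a + 1) / (2 * b)).
  suff -> : a + 2 * (- (a + 1) / (2 * b)) * b + (- (a + 1) / (2 * b)) ^+ 2 * 0 = -1 by lra.
  by field.
have c_gt0 : 0 < c by rewrite lt_def c_neq0.
(* The minimizer of the quadratic. *)
have := quad (- b / c).
have -> : a + 2 * (- b / c) * b + (- b / c) ^+ 2 * c = (a * c - b ^+ 2) / c by field.
by rewrite pmulr_lge0 ?invr_gt0// subr_ge0.
Qed.

End Dot.

Lemma fnorm_mulmx_sqr (R : realType) m n (A : 'M[R]_(m, n)) (x : 'cV[R]_n) :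
  fnorm (A *m x) ^+ 2 = \sum_j dot x (arow A j) ^+ 2.
Proof.
rewrite fnorm_sqr; apply: eq_bigr => j _; rewrite big_ord1 mxE; congr (_ ^+ 2).
by apply: eq_bigr => k _; rewrite !mxE mulrC.
Qed.

Lemma fnorm_rows_in_sqr (R : realType) m n (A : 'M[R]_(m, n)) S (x : 'cV[R]_n) :
  fnorm (rows_in A S *m x) ^+ 2 = \sum_(j in S) dot x (arow A j) ^+ 2.
Proof.
rewrite fnorm_mulmx_sqr [RHS]big_enum_val/=; apply: eq_bigr => j _.
by congr (dot _ _ ^+ 2); apply/matrixP => k l; rewrite !mxE.
Qed.

(** Cauchy-Schwarz on each row. This crude bound makes the Rayleigh quotients bounded and controls
    [invmx N] below. *)
Lemma fnorm_mulmx_le (R : realType) m n (A : 'M[R]_(m, n)) (x : 'cV[R]_n) :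
  fnorm (A *m x) ^+ 2 <= fnorm A ^+ 2 * fnorm x ^+ 2.
Proof.
rewrite fnorm_mulmx_sqr (fnorm_sqr A) mulr_suml ler_sum// => j _.
have := @CauchySchwarz_psd R n 1%:M x (arow A j).
rewrite trmx1 !mul1mx !dot_fnorm mulrC => /(_ erefl)/=.
have -> : fnorm (arow A j) ^+ 2 = \sum_k A j k ^+ 2.
  by rewrite fnorm_sqr; apply: eq_bigr => k _; rewrite big_ord1 !mxE.
by apply => y; rewrite mul1mx dot_fnorm sqr_ge0.
Qed.

(** * The largest singular value as a supremum of Rayleigh quotients *)

Section SigmaMax.
Context (R : realType) (m n : nat) (A : 'M[R]_(m, n)).
Implicit Types x y : 'cV[R]_n.

Let rayleigh := [set fnorm (A *m y) ^+ 2 | y in [set y : 'cV[R]_n | fnorm y = 1]].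

Let rayleigh_ub : has_ubound rayleigh.
Proof.
exists (fnorm A ^+ 2) => _ [y y1 <-].
by have := fnorm_mulmx_le A y; rewrite y1 expr1n mulr1.
Qed.

Let rayleigh_le x : fnorm (A *m x) ^+ 2 <= sup rayleigh * fnorm x ^+ 2.
Proof.
have [->|x0] := eqVneq x 0.
  by rewrite mulmx0 !fnorm0 expr0n mulr0.
have /(ub_le_sup rayleigh_ub) : rayleigh (fnorm (A *m ((fnorm x)^-1 *: x)) ^+ 2).
  by exists ((fnorm x)^-1 *: x) => //=; exact: fnorm_normalize.
rewrite -scalemxAr fnormZ exprVn ler_pdivrMl; first by rewrite mulrC.
by rewrite exprn_gt0// lt_def sqrtr_ge0 fnorm_eq0 x0.
Qed.

(* If [sup rayleigh - A^T A] were invertible, Cauchy-Schwarz for this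
   semidefinite form would make it uniformly positive on the sphere. *)
Let sup_rayleigh_eigenvalue x : x != 0 -> eigenvalue (A^T *m A) (sup rayleigh).
Proof.
move=> x0; set l := sup rayleigh; pose N := l%:M - A^T *m A.
have NE y : dot y (N *m y) = l * fnorm y ^+ 2 - fnorm (A *m y) ^+ 2.
  rewrite mulmxBl mul_scalar_mx dotDr dotZr dot_fnorm -mulmxA -scaleN1r dotZr.
  by rewrite dot_trmx trmxK dot_fnorm mulN1r.
have Npsd y : 0 <= dot y (N *m y) by rewrite NE subr_ge0 rayleigh_le.
have Nsym : N^T = N by rewrite linearB/= tr_scalar_mx trmx_mul trmxK.
have [/det0P[v v0 vN]|Nunit] := boolP (\det N == 0).
  apply/eigenvalueP; exists v => //; apply/eqP.
  by rewrite eq_sym -subr_eq0 -mul_mx_scalar -mulmxBr vN.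
have {}Nunit : N \in unitmx by rewrite unitmxE unitfE.
(* [K] bounds [dot y (invmx N *m y)] on the unit sphere. Every Rayleigh quotient then lies below [l]
   by at least [K^-1], which contradicts the choice of [l] as their supremum. *)
pose K := 1 + fnorm (invmx N) ^+ 2.
have K0 : 0 < K by rewrite ltr_pwDl// sqr_ge0.
suff : l <= l - K^-1 by rewrite lerBrDr gerDl leNgt invr_gt0 K0.
apply: ge_sup.
  exists (fnorm (A *m ((fnorm x)^-1 *: x)) ^+ 2), ((fnorm x)^-1 *: x) => //=.
  exact: fnorm_normalize.
move=> _ [y /= y1 <-]; pose z := invmx N *m y.
have Nz : N *m z = y by rewrite mulmxA mulmxV// mul1mx.
(* As [N *m z = y], this reads [1 <= (l - |A y|^2) * dot y z] for the unit vector [y]. *)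
have := CauchySchwarz_psd y z Nsym Npsd.
rewrite Nz dot_fnorm NE y1 !expr1n mulr1 (dotC z) => CS.
have yzK : dot y z <= K.
  have zK : fnorm z ^+ 2 <= fnorm (invmx N) ^+ 2.
    by have := fnorm_mulmx_le (invmx N) y; rewrite y1 expr1n mulr1.
  (* Expanding [|y - z|^2 >= 0] gives [2 * dot y z <= 1 + |z|^2]. *)
  have := sqr_ge0 (fnorm (y + (-1) *: z)).
  by rewrite fnorm_sqr_addZ y1 /K; have := sqr_ge0 (fnorm z); lra.
have d0 : 0 <= l - fnorm (A *m y) ^+ 2.
  by have := rayleigh_le y; rewrite y1 expr1n mulr1 subr_ge0.
rewrite lerBrDr -lerBrDl -[K^-1]mul1r ler_pdivrMr//.
by apply: (le_trans CS); rewrite ler_wpM2l.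
Qed.

(** The supremum of the Rayleigh quotients is itself an eigenvalue of [A^T A], so its square root is
    among the numbers whose supremum is [sigma_max A]. *)
Lemma le_sigma_max x :
  \sum_j dot x (arow A j) ^+ 2 <= sigma_max A ^+ 2 * fnorm x ^+ 2.
Proof.
rewrite -fnorm_mulmx_sqr; apply: (le_trans (rayleigh_le x)).
have [->|x0] := eqVneq x 0.
  by rewrite !fnorm0 expr0n !mulr0.
rewrite ler_wpM2r ?sqr_ge0//.
have l0 : 0 <= sup rayleigh.
  have := le_trans (sqr_ge0 _) (rayleigh_le ((fnorm x)^-1 *: x)).
  by rewrite fnorm_normalize// expr1n mulr1.
have le_sup : Num.sqrt (sup rayleigh) <= sigma_max A.
  apply: ub_le_sup; last first.
    by exists (sup rayleigh) => //=; exact: sup_rayleigh_eigenvalue x0.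
  (* Every eigenvalue is a Rayleigh quotient, so the set of singular values is bounded. Eigenvectors
     are row vectors here, hence the transposes. *)
  exists (Num.sqrt (sup rayleigh)) => _ [l /= /eigenvalueP[v vl v0] <-].
  rewrite ler_wsqrtr//; have := rayleigh_le v^T.
  have AAv : A^T *m (A *m v^T) = l *: v^T.
    by apply: trmx_inj; rewrite !trmx_mul !trmxK -mulmxA vl linearZ/= trmxK.
  rewrite -dot_fnorm dot_trmx AAv dotZl dot_fnorm.
  rewrite ler_pM2r// exprn_gt0// lt_def sqrtr_ge0.
  by rewrite fnorm_eq0 trmx_eq0 v0.
by rewrite -(sqr_sqrtr l0) ler_sqr ?nnegrE ?(le_trans _ le_sup)// sqrtr_ge0.
Qed.

End SigmaMax.

(** * Lower bounds from the restricted smallest singular value *)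

(** Only subsets of exactly [alpha * m] rows enter [sigma_min], so [S] is first cut down to such a
    subset [S']; the squares dropped are nonnegative. *)
Lemma sigma_min_le (R : realType) m n (A : 'M[R]_(m, n)) alpha
    (S : {set 'I_m}) (x : 'cV[R]_n) :
    alpha * m%:R \is a Num.nat -> alpha * m%:R <= #|S|%:R ->
  sigma_min alpha A ^+ 2 * fnorm x ^+ 2 <= \sum_(j in S) dot x (arow A j) ^+ 2.
Proof.
move=> /natrP[k alphaE]; rewrite alphaE ler_nat => kS.
have [->|x0] := eqVneq x 0.
  by rewrite fnorm0 expr0n mulr0 sumr_ge0// => j _; rewrite sqr_ge0.
have [S' S'S cardS'] : exists2 S' : {set 'I_m}, S' \subset S & #|S'| = k.
  exists [set j in take k (enum S)]; last first.
    by rewrite cardsE (card_uniqP _) ?take_uniq ?enum_uniq// size_takel// -cardE.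
  by apply/fintype.subsetP => j; rewrite inE => /mem_take; rewrite mem_enum.
pose values (S1 : {set 'I_m}) :=
  [set fnorm (rows_in A S1 *m y) | y in [set y : 'cV[R]_n | fnorm y = 1]].
have sphere0 (S1 : {set 'I_m}) : values S1 !=set0.
  exists (fnorm (rows_in A S1 *m ((fnorm x)^-1 *: x))), ((fnorm x)^-1 *: x) => //=.
  exact: fnorm_normalize.
have inner_ge0 (S1 : {set 'I_m}) : 0 <= inf (values S1).
  by apply: lb_le_inf => // _ [y _ <-]; exact: sqrtr_ge0.
have sigma_ge0 : 0 <= sigma_min alpha A.
  apply: lb_le_inf => [|_ [S1 _ <-]]; last exact: inner_ge0.
  by eexists; exists S' => //=; rewrite cardS' alphaE.
have sigma_le : sigma_min alpha A <= fnorm (rows_in A S' *m ((fnorm x)^-1 *: x)).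
  apply: (@le_trans _ _ (inf (values S'))).
    apply: ge_inf; last by exists S' => //=; rewrite cardS' alphaE.
    by exists 0 => _ [S1 _ <-]; exact: inner_ge0.
  apply: ge_inf; first by exists 0 => _ [y _ <-]; exact: sqrtr_ge0.
  by exists ((fnorm x)^-1 *: x) => //=; exact: fnorm_normalize.
have {sigma_le} : sigma_min alpha A ^+ 2 <= fnorm (rows_in A S' *m ((fnorm x)^-1 *: x)) ^+ 2.
  by rewrite ler_sqr ?nnegrE ?sqrtr_ge0.
rewrite -scalemxAr fnormZ exprVn ler_pdivlMl; last first.
  by rewrite exprn_gt0// lt_def sqrtr_ge0 fnorm_eq0 x0.
rewrite mulrC => /le_trans; apply.
rewrite fnorm_rows_in_sqr [leRHS](big_setID S')/= (finset.setIidPr S'S) lerDl.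
by rewrite sumr_ge0// => j _; rewrite sqr_ge0.
Qed.

(** * Quantile index sets and an averaging inequality over them *)

Section Quantile.
Context (R : realType) (m : nat) (s : 'I_m -> R).
Local Open Scope nat_scope.

Let sorted_s := sort (fun i j => (s i <= s j)%R) (enum 'I_m).

Let mem_sorted_s i : i \in sorted_s.
Proof. by rewrite mem_sort mem_enum. Qed.

(** Integrality makes the truncation exact, and [q <= 1] keeps the prefix within the list of all
    indices. *)
Lemma card_low_quantile (q : R) : (q * m%:R \is a Num.nat)%R -> (q <= 1)%R ->
  (#|low_quantile q s|%:R = q * m%:R)%R.
Proof.
move=> qm q1; rewrite cardsE (card_uniqP _) ?take_uniq ?sort_uniq ?enum_uniq//.
rewrite size_takel ?truncnK// size_sort size_enum_ord.
by rewrite -(ler_nat R) truncnK// -[leRHS]mul1r ler_wpM2r.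
Qed.

(** In a sorted list every entry of a prefix precedes every entry of the remaining suffix. *)
Lemma low_quantile_le (q : R) i j :
  i \in low_quantile q s -> j \notin low_quantile q s -> (s i <= s j)%R.
Proof.
rewrite !inE => iq jq.
have := sort_sorted (fun i j => ge_total (s j) (s i)) (enum 'I_m).
rewrite -/sorted_s sorted_pairwise => [|? ? ?]; last exact: le_trans.
have sE := cat_take_drop (Num.truncn (q * m%:R)%R) sorted_s.
rewrite -[sorted_s in pairwise _ sorted_s]sE pairwise_cat.
move=> /and3P[/allrelP + _ _]; apply => //.
by have := mem_sorted_s j; rewrite -[in _ \in _]sE mem_cat (negPf jq).
Qed.

Lemma low_quantile_subset (q q' : R) : (q <= q')%R ->
  low_quantile q s \subset low_quantile q' s.
Proof.
move=> qq'; apply/fintype.subsetP => i; rewrite !inE.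
rewrite -(take_takel (j := Num.truncn (q' * m%:R))); first exact: mem_take.
by apply: le_truncn; rewrite ler_wpM2r.
Qed.

End Quantile.

(* The maximum [v] of [r] on [L0] is at least the mean of [r] on [L0 :&: G].
   Adding [v] once to the sum over [L1 :&: G] is free because [j0 \in L0]
   contributes nothing, so the mean over the [|L1|] slots only increases when
   restricted to [G :&: (L1 :\: L0)], where [r >= v]. *)
Lemma sum_upper_part_ge (R : realType) (I : finType) (L0 L1 G : {set I})
    (r : I -> R) (c : R) (j0 : I) :
    L0 \subset L1 -> (forall i, 0 <= r i) ->
    (forall i j, i \in L0 -> j \notin L0 -> r i <= r j) ->
    j0 \in L0 -> r j0 = 0 -> 0 <= c <= #|(G :&: (L1 :\: L0))%SET|%:R ->
  c * ((\sum_(i in G :&: L1) r i + (\sum_(i in G :&: L0) r i) / #|L0|%:R) / #|L1|%:R)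
    <= \sum_(i in G :&: (L1 :\: L0)) r i.
Proof.
move=> sL r0 rle j0L rj0 /andP[c0 cle].
have L0_gt0 : 0 < #|L0|%:R :> R by rewrite ltr0n card_gt0; apply/set0Pn; exists j0.
have L1E : #|L1|%:R = #|L0|%:R + #|L1 :\: L0|%:R :> R.
  by rewrite -natrD -(cardsID L0 L1) (finset.setIidPr sL).
have cardB : #|(G :&: (L1 :\: L0))%SET|%:R <= #|L1 :\: L0|%:R :> R.
  by rewrite ler_nat subset_leq_card// finset.subsetIr.
have [jm jmL jmax] : exists2 j, j \in L0 & forall i, i \in L0 -> r i <= r j.
  by case: (arg_maxP r j0L) => j jL jP; exists j.
have S1E : \sum_(i in G :&: L1) r i
    = \sum_(i in G :&: L0) r i + \sum_(i in G :&: (L1 :\: L0)) r i.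
  rewrite (big_setID L0)/= -finset.setIA (finset.setIidPr sL); congr (_ + _).
  by rewrite finset.setIDA.
(* The vanishing term at [j0] replaces the count [#|L0|] by [#|L0| - 1], leaving room for one more
   [v] when the mean over [L0] is added. *)
have S0le : \sum_(i in G :&: L0) r i <= (#|L0|%:R - 1) * r jm.
  apply: (@le_trans _ _ (\sum_(i in L0) r i)).
    rewrite [leRHS](big_setID G)/= finset.setIC lerDl.
    by apply: sumr_ge0.
  rewrite (big_setD1 j0)//= rj0 add0r.
  have -> : #|L0|%:R - 1 = #|(L0 :\ j0)%SET|%:R :> R.
    by rewrite [in LHS](cardsD1 j0) j0L natrD addrC addKr.
  rewrite mulr_natl -sumr_const ler_sum// => i; rewrite !inE => /andP[_]; exact: jmax.
have SBge : #|(G :&: (L1 :\: L0))%SET|%:R * r jm <= \sum_(i in G :&: (L1 :\: L0)) r i.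
  rewrite mulr_natl -sumr_const ler_sum// => i; rewrite !inE => /and3P[_ iL _].
  exact: rle.
have L1_gt0 : 0 < #|L1|%:R :> R by rewrite L1E ltr_pwDl.
rewrite mulrA ler_pdivrMr//.
have S0v : (\sum_(i in G :&: L0) r i) / #|L0|%:R <= r jm.
  by rewrite ler_pdivrMr//; have := r0 jm; nra.
rewrite S1E L1E.
move: S0le SBge S0v cle cardB (r0 jm) c0 L0_gt0.
set S0 := \sum_(i in _) r i; set SB := \sum_(i in _) r i.
set l0 : R := #|L0|%:R; set lG : R := #|_|%:R; set lB : R := #|_|%:R.
set v := r jm.
move=> S0le SBge S0vle cle lBle v0 c0 l0_gt0.
have SB0 : 0 <= SB by apply: le_trans SBge; rewrite mulr_ge0// (le_trans c0).
(* The sum over [G :&: L0] and its mean together cost at most [(l0 - 1) * v + v]. Afterwards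
   [lG * v <= SB] and [lG <= lB] give the factor [l0 + lB]. *)
apply: (@le_trans _ _ (c * (SB + l0 * v))); first by rewrite ler_wpM2l//; lra.
apply: (@le_trans _ _ (lG * (SB + l0 * v))).
  by rewrite ler_wpM2r// addr_ge0// mulr_ge0// ltW.
have : l0 * (lG * v) <= l0 * SB by rewrite ler_wpM2l// ltW.
have : lG * SB <= lB * SB by rewrite ler_wpM2r.
lra.
Qed.

(** * Contraction of the squared error in one step *)

(** The constant [C] of the theorem. *)
Definition dqRK_rate (R : realType) m n (A : 'M[R]_(m, n)) (beta q0 q1 : R) : R :=
  (q1 - q0 - beta)
    * (sigma_min (q1 - beta) A ^+ 2 / ((q1 - q0) * q1 * m%:R)
       + sigma_min (q0 - beta) A ^+ 2 / ((q1 - q0) * q0 * q1 * m%:R ^+ 2))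
  - sigma_max A ^+ 2 / ((q1 - q0) * m%:R)
    * (2 * Num.sqrt beta / Num.sqrt (1 - q1 - beta) + beta / (1 - q1 - beta)).

Section OneStep.
Context (R : realType) (m n : nat) (A : 'M[R]_(m, n)).
Hypothesis hrow : forall j : 'I_m, fnorm (arow A j) = 1.
Context (be b : 'cV[R]_m) (xs : 'cV[R]_n).
Hypothesis hb : b = A *m xs + be.
Context (beta q0 q1 : R).
Hypotheses (hbeta : 0 <= beta) (hbe : (norm0 be)%:R <= beta * m%:R).
Hypotheses (hbetam : beta * m%:R \is a Num.int).
Hypotheses (hq0m : q0 * m%:R \is a Num.int) (hq1m : q1 * m%:R \is a Num.int).
Hypotheses (hbeta_q0 : beta < q0) (hq1_beta : q1 < 1 - beta).
Hypothesis hgap : beta < q1 - q0.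
Context (y : 'cV[R]_n).
Hypothesis hy : exists i : 'I_m, dot y (arow A i) = b i 0.

Let e := y - xs.
Let t j := dot e (arow A j).
Let rho j := b j 0 - dot y (arow A j).
Let G := [set j | be j 0 == 0]%SET.
Let L0 := low_quantile q0 (residual A b y).
Let L1 := low_quantile q1 (residual A b y).
Let B := dqRK_block A b q0 q1 y.

Let m_gt0 : 0 < m%:R :> R.
Proof. by have [i _] := hy; rewrite ltr0n (leq_ltn_trans _ (ltn_ord i)). Qed.

Let bounds : [/\ 0 <= beta, beta < q0, q1 < 1 - beta, beta < q1 - q0 & 0 < m%:R :> R].
Proof. by []. Qed.

Let bad_card (S : {set 'I_m}) : #|(S :\: G)%SET|%:R <= beta * m%:R.
Proof.
apply: le_trans hbe; rewrite ler_nat; apply: subset_leq_card.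
by apply/fintype.subsetP => j; rewrite !inE => /andP[].
Qed.

Let good_card (S : {set 'I_m}) : #|S|%:R - beta * m%:R <= #|(G :&: S)%SET|%:R.
Proof. by have := bad_card S; rewrite -(cardsID G S) natrD finset.setIC; lra. Qed.

(** The exact right-hand side is [A *m xs], so the signed residual splits into corruption and error;
    on [G] it is just [- t j]. *)
Let rhoE j : rho j = be j 0 - t j.
Proof.
have -> : t j = dot y (arow A j) - dot xs (arow A j).
  by rewrite /t /e -scaleN1r dotDl dotZl mulN1r.
rewrite /rho hb mxE; suff -> : (A *m xs) j 0 = dot xs (arow A j) by ring.
by rewrite mxE; apply: eq_bigr => k _; rewrite !mxE mulrC.
Qed.

Let rho_good j : j \in G -> rho j ^+ 2 = t j ^+ 2.
Proof. by rewrite inE rhoE => /eqP ->; rewrite sub0r sqrrN. Qed.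

Let residual_le i j : residual A b y i <= residual A b y j -> rho i ^+ 2 <= rho j ^+ 2.
Proof.
rewrite /residual !hrow !divr1 !(distrC (dot _ _)) => ij.
by rewrite -[leLHS]real_normK ?num_real// -[leRHS]real_normK ?num_real// ler_sqr ?nnegrE.
Qed.

Let int_nat (a : R) : 0 <= a -> a \is a Num.int -> a \is a Num.nat.
Proof. by move=> a0; rewrite intrEge0. Qed.

Let card_L0 : #|L0|%:R = q0 * m%:R.
Proof.
case: bounds => ? ? ? ? ?; apply: card_low_quantile; [apply: int_nat => //; nra|lra].
Qed.

Let card_L1 : #|L1|%:R = q1 * m%:R.
Proof.
case: bounds => ? ? ? ? ?; apply: card_low_quantile; [apply: int_nat => //; nra|lra].
Qed.

Let L0_sub_L1 : L0 \subset L1.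
Proof. by case: bounds => ? ? ? ? ?; apply: low_quantile_subset; lra. Qed.

Let card_B : #|B|%:R = (q1 - q0) * m%:R.
Proof.
have : #|L1|%:R = #|L0|%:R + #|B|%:R :> R.
  by rewrite -natrD -(cardsID L0 L1) (finset.setIidPr L0_sub_L1).
by rewrite card_L0 card_L1; lra.
Qed.

(** [y] solves some equation [i0]. If [i0] is outside [L0], any member of the nonempty set [L0] has
    a residual no larger than that of [i0], hence zero. *)
Let zero_in_L0 : exists2 j0, j0 \in L0 & rho j0 ^+ 2 = 0.
Proof.
case: bounds => ? ? ? ? ?.
have [i0 i0E] := hy.
have rho_i0 : rho i0 ^+ 2 = 0 by rewrite /rho i0E subrr expr0n.
have [i0L|i0L] := boolP (i0 \in L0); first by exists i0.
have /set0Pn[j jL] : L0 != finset.set0.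
  by rewrite -card_gt0 -(ltr0n R) card_L0; nra.
exists j => //; apply/eqP; rewrite eq_le sqr_ge0 andbT -rho_i0.
exact/residual_le/(low_quantile_le jL).
Qed.

(** The averaging inequality is applied to the squared residuals with [c = (q1 - q0 - beta) * m], a
    lower bound for the number of uncorrupted indices in [B]. Likewise [G] keeps at least
    [(q - beta) * m] indices of each quantile set, so [sigma_min] bounds the sums over [L0] and
    [L1]. *)
Let good_part :
  (q1 - q0 - beta) * m%:R
    * ((sigma_min (q1 - beta) A ^+ 2 + sigma_min (q0 - beta) A ^+ 2 / (q0 * m%:R))
        / (q1 * m%:R)) * fnorm e ^+ 2
  <= \sum_(j in G :&: B) t j ^+ 2.
Proof.
case: bounds => ? ? ? ? ?.
have [j0 j0L rho0] := zero_in_L0.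
have sum_rho S : \sum_(j in G :&: S) rho j ^+ 2 = \sum_(j in G :&: S) t j ^+ 2.
  by apply: eq_bigr => j; rewrite inE => /andP[/rho_good].
have sigma_le q : q * m%:R \is a Num.int -> beta < q ->
    #|low_quantile q (residual A b y)|%:R = q * m%:R ->
    sigma_min (q - beta) A ^+ 2 * fnorm e ^+ 2
    <= \sum_(j in G :&: low_quantile q (residual A b y)) t j ^+ 2.
  move=> qm bq cardL; apply: sigma_min_le.
    by apply: int_nat; [nra|rewrite mulrBl rpredB].
  by rewrite mulrBl -cardL.
have := @sum_upper_part_ge R _ L0 L1 G (fun j => rho j ^+ 2)
  ((q1 - q0 - beta) * m%:R) j0 L0_sub_L1.
rewrite !sum_rho card_L0 card_L1 => /(_ _ _ j0L rho0) H.
apply: le_trans (H _ _ _); last 3 first.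
- by move=> j; exact: sqr_ge0.
- by move=> i j iL jL; exact/residual_le/(low_quantile_le iL).
- apply/andP; split; first by nra.
  by have := good_card B; rewrite card_B -/B /B /dqRK_block -/L0 -/L1; lra.
have q0m_gt0 : 0 < q0 * m%:R by nra.
have q1m_gt0 : 0 < q1 * m%:R by nra.
rewrite -mulrA ler_wpM2l; [by []|nra|].
rewrite mulrAC ler_pM2r ?invr_gt0// mulrDl lerD ?sigma_le//; first lra.
by rewrite mulrAC ler_pM2r ?invr_gt0// sigma_le.
Qed.

Let kappa := 2 * Num.sqrt beta / Num.sqrt (1 - q1 - beta) + beta / (1 - q1 - beta).

(** Each summand is the change of [|e|^2] caused by projecting onto a corrupted row. The cross term
    is split by AM-GM; there are at most [beta * m] summands, each [rho j ^+ 2] is small, and the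
    [t j ^+ 2] sum to at most [Sg]. *)
Let bad_part :
  \sum_(j in B :\: G) (2 * rho j * t j + rho j ^+ 2)
    <= sigma_max A ^+ 2 * kappa * fnorm e ^+ 2.
Proof.
case: bounds => ? ? ? ? ?.
set D := 1 - q1 - beta; have D0 : 0 < D by rewrite /D; lra.
set Sg := sigma_max A ^+ 2 * fnorm e ^+ 2.
have Sg0 : 0 <= Sg by rewrite mulr_ge0 ?sqr_ge0.
have sum_t (S : {set 'I_m}) : \sum_(j in S) t j ^+ 2 <= Sg.
  apply: le_trans (le_sigma_max A e); rewrite [leRHS](bigID (mem S))/= lerDl.
  by apply: sumr_ge0 => j _; exact: sqr_ge0.
have -> : sigma_max A ^+ 2 * kappa * fnorm e ^+ 2 = Sg * kappa by rewrite /Sg; ring.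
(* Without corruption the sum is empty; this case is separate because the weight [c] below divides
   by [Num.sqrt beta]. *)
have [beta0|beta_neq0] := eqVneq beta 0.
  have /eqP : #|(B :\: G)%SET| = 0%N.
    by apply/eqP; rewrite -leqn0 -(ler_nat R) (le_trans (bad_card B))// beta0 mul0r.
  rewrite cards_eq0 => /eqP ->; rewrite big_set0 mulr_ge0//.
  by rewrite /kappa addr_ge0// ?divr_ge0// ?mulr_ge0 ?sqrtr_ge0// ltW.
have rho_le j : j \in (B :\: G)%SET -> rho j ^+ 2 <= Sg / (D * m%:R).
  rewrite !inE => /and3P[_ _ jL1].
  rewrite ler_pdivlMr ?mulr_gt0//.
  (* The uncorrupted indices outside [L1] number at least [D * m], and each has
     [t i ^+ 2 = rho i ^+ 2 >= rho j ^+ 2]. *)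
  apply: le_trans (sum_t (G :&: ~: L1)%SET).
  apply: (@le_trans _ _ (rho j ^+ 2 * #|(G :&: ~: L1)%SET|%:R)).
    rewrite ler_wpM2l ?sqr_ge0//; apply: le_trans (good_card _).
    have /(congr1 (fun k => k%:R : R)) := cardsC L1.
    by rewrite natrD card_L1 card_ord /D; lra.
  rewrite mulr_natr -sumr_const ler_sum// => i; rewrite !inE => /andP[iG iL1].
  rewrite -rho_good ?inE//; apply: residual_le.
  by apply: (@low_quantile_le _ _ _ q1); rewrite ?inE.
(* The weight minimizing [c * beta / D + 1 / c] in the AM-GM bound below. *)
pose c := Num.sqrt D / Num.sqrt beta.
have sb0 : 0 < Num.sqrt beta by rewrite sqrtr_gt0 lt_def beta_neq0.
have sD0 : 0 < Num.sqrt D by rewrite sqrtr_gt0.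
have c0 : 0 < c by rewrite divr_gt0.
apply: (@le_trans _ _ (\sum_(j in B :\: G) ((c + 1) * (Sg / (D * m%:R)) + t j ^+ 2 / c))).
  apply: ler_sum => j /rho_le rj.
  apply: (@le_trans _ _ ((c + 1) * rho j ^+ 2 + t j ^+ 2 / c)); last first.
    by rewrite lerD2r ler_wpM2l// addr_ge0// ltW.
  have : 0 <= (c * rho j - t j) ^+ 2 / c by rewrite divr_ge0 ?sqr_ge0// ltW.
  have -> : (c * rho j - t j) ^+ 2 / c = c * rho j ^+ 2 - 2 * rho j * t j + t j ^+ 2 / c.
    by field; rewrite gt_eqF.
  lra.
rewrite big_split/= sumr_const -mulr_suml -[_ *+ #|_|]mulr_natl.
apply: (@le_trans _ _ (beta * m%:R * ((c + 1) * (Sg / (D * m%:R))) + Sg / c)).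
  apply: lerD; last by rewrite ler_pM2r ?invr_gt0.
  apply: ler_wpM2r (bad_card B); apply: mulr_ge0; first by rewrite addr_ge0// ltW.
  by rewrite divr_ge0// mulr_ge0// ltW.
(* For this [c] the two sides agree: [beta * c / D] and [1 / c] both equal
   [Num.sqrt beta / Num.sqrt D]. *)
rewrite le_eqVlt; apply/orP; left; apply/eqP; rewrite /kappa -/D /c.
have betaE : beta = Num.sqrt beta ^+ 2 by rewrite sqr_sqrtr.
have DE : D = Num.sqrt D ^+ 2 by rewrite sqr_sqrtr// ltW.
set sb := Num.sqrt beta in sb0 betaE *; set sD := Num.sqrt D in sD0 DE *.
rewrite betaE DE.
by field; rewrite !gt_eqF.
Qed.

Lemma one_step :
  \sum_j dqRK_prob A b q0 q1 y j * fnorm (kaczmarz_step A b y j - xs) ^+ 2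
    <= (1 - dqRK_rate A beta q0 q1) * fnorm (y - xs) ^+ 2.
Proof.
rewrite -/e; case: bounds => ? ? ? ? ?.
have B_gt0 : 0 < #|B|%:R :> R by rewrite card_B; nra.
have stepE j : fnorm (kaczmarz_step A b y j - xs) ^+ 2
    = fnorm e ^+ 2 + (2 * rho j * t j + rho j ^+ 2).
  rewrite /kaczmarz_step hrow expr1n divr1 addrAC fnorm_sqr_addZ hrow.
  by rewrite -/e -/(rho j) -/(t j); ring.
(* With unit rows the squared Frobenius norm of the block is [#|B|], so the selection is uniform on
   [B]. *)
have probE j : dqRK_prob A b q0 q1 y j = if j \in B then #|B|%:R^-1 else 0.
  rewrite /dqRK_prob -/B hrow expr1n mul1r; case: ifP => // _; congr _^-1.
  rewrite fnorm_sqr -sumr_const [RHS]big_enum_val; apply: eq_bigr => i _.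
  have <- : fnorm (arow A (enum_val i)) ^+ 2 = 1 by rewrite hrow expr1n.
  by rewrite fnorm_sqr; apply: eq_bigr => l _; rewrite big_ord1 !mxE.
have -> : \sum_j dqRK_prob A b q0 q1 y j * fnorm (kaczmarz_step A b y j - xs) ^+ 2
    = #|B|%:R^-1 * (#|B|%:R * fnorm e ^+ 2 + \sum_(j in B) (2 * rho j * t j + rho j ^+ 2)).
  rewrite [#|B|%:R * _]mulr_natl -[fnorm e ^+ 2 *+ _]sumr_const -big_split.
  rewrite mulr_sumr/= [RHS]big_mkcond/=.
  by apply: eq_bigr => j _; rewrite probE stepE; case: ifP => // _; rewrite mul0r.
rewrite (big_setID G)/= finset.setIC.
(* On uncorrupted rows [rho j = - t j], and the change [2 rho t + rho^2] is a pure decrease. *)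
have -> : \sum_(j in G :&: B) (2 * rho j * t j + rho j ^+ 2) = - \sum_(j in G :&: B) t j ^+ 2.
  rewrite -sumrN; apply: eq_bigr => j; rewrite !inE rhoE => /andP[/eqP -> _]; ring.
rewrite mulrC ler_pdivrMr//.
(* Multiplied by [#|B| = (q1 - q0) * m], the rate separates into exactly the bounds of [good_part]
   and [bad_part]. *)
have -> : (1 - dqRK_rate A beta q0 q1) * fnorm e ^+ 2 * #|B|%:R = #|B|%:R * fnorm e ^+ 2
   + (- ((q1 - q0 - beta) * m%:R
    * ((sigma_min (q1 - beta) A ^+ 2 + sigma_min (q0 - beta) A ^+ 2 / (q0 * m%:R))
        / (q1 * m%:R)) * fnorm e ^+ 2) + sigma_max A ^+ 2 * kappa * fnorm e ^+ 2).
  rewrite card_B /dqRK_rate -/kappa; field; rewrite !gt_eqF//; lra.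
by rewrite lerD2l lerD ?lerN2 ?good_part ?bad_part.
Qed.

End OneStep.

(** * Finite-valued expectations and geometric decay *)

(** [f \o H] is a finite combination of indicators of the fibres of [H]; nonnegativity of [f] allows
    integration term by term. *)
Lemma expectation_finite_valued (R : realType) d (T : measurableType d)
    (P : probability T R) (I : finType) (H : T -> I) (f : I -> R) :
    (forall h, measurable (H @^-1` [set h])) -> (forall h, 0 <= f h) ->
  ('E_P[fun w => f (H w)])%E = (\sum_h f h * fine (P (H @^-1` [set h])))%:E.
Proof.
move=> mH f0; rewrite unlock.
under eq_integral => w _.
  have -> : (f (H w))%:E = (\sum_h (f h * \1_(H @^-1` [set h]) w)%:E)%E.
    rewrite sumEFin (bigD1 (H w))//= indicE mem_set// mulr1 big1 ?addr0// => h hH.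
    by rewrite indicE memNset ?mulr0//= => /esym/eqP; rewrite (negPf hH).
  over.
rewrite ge0_integral_sum//; last 2 first.
- move=> h; apply/measurable_EFinP; apply: measurable_funM => //.
- by move=> h w _; rewrite lee_fin mulr_ge0.
rewrite -sumEFin; apply: eq_bigr => h _.
rewrite (@integralZl_indic _ _ _ _ _ measurableT (fun=> H @^-1` [set h]))//; last first.
  by move=> fh0; have := f0 h; rewrite leNgt fh0.
by rewrite integral_indic// setIT EFinM fineK// fin_num_measure.
Qed.

(** If [a 0 > 0], then [0 <= a 1 <= c * a 0] forces [c >= 0] and the induction goes through; if
    [a 0 = 0], the whole sequence vanishes. *)
Lemma le_geometric (R : realDomainType) (a : nat -> R) (c : R) :
    (forall k, 0 <= a k) -> (forall k, a k.+1 <= c * a k) ->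
  forall k, a k <= c ^+ k * a 0%N.
Proof.
move=> a0 ac; have [a00|a00] := eqVneq (a 0%N) 0.
  suff aE k : a k = 0 by move=> k; rewrite !aE mulr0.
  by elim: k => // k IH; apply/eqP; rewrite eq_le a0 andbT (le_trans (ac k))// IH mulr0.
have c0 : 0 <= c.
  by rewrite -(pmulr_lge0 _ (_ : 0 < a 0%N)) ?(le_trans _ (ac 0%N))// lt_def a00 a0.
elim=> [|k IH]; first by rewrite expr0 mul1r.
by rewrite (le_trans (ac k))// exprS -mulrA ler_wpM2l.
Qed.

(** * Runs of the algorithm through their finite histories *)

Section Run.
Context (R : realType) (m n : nat) (A : 'M[R]_(m, n)) (b : 'cV[R]_m) (q0 q1 : R).
Context (x0 : 'cV[R]_n) (d : measure_display) (T : measurableType d).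
Context (P : probability T R) (i : nat -> T -> 'I_m) (x : nat -> T -> 'cV[R]_n).
Hypothesis hrun : is_dqRK A b q0 q1 x0 P i x.

(** As [x0] is fixed, the [k]-th iterate is a deterministic function of the first [k] selected rows,
    so expectations become finite sums over tuples. *)
Let hist k w : k.-tuple 'I_m := [tuple i l w | l < k].
Let iterate (h : seq 'I_m) := foldl (kaczmarz_step A b) x0 h.

Let hist_eq k v w : hist k v = hist k w <-> forall l, (l < k)%N -> i l v = i l w.
Proof.
split=> [h l lk|h]; last by apply: eq_from_tnth => l; rewrite !tnth_mktuple h.
by have := congr1 (fun t => tnth t (Ordinal lk)) h; rewrite !tnth_mktuple.
Qed.

Let iterE k w : x k w = iterate (hist k w).
Proof.
have histE l : hist l w = [seq i j w | j <- iota 0 l] :> seq _.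
  by rewrite /= -val_enum_ord -map_comp.
elim: k => [|k IH]; first by rewrite (dqRK_init hrun) histE.
have iotaS : iota 0 k.+1 = iota 0 k ++ [:: k] by rewrite -addn1 iotaD.
rewrite (dqRK_next hrun) IH !histE iotaS map_cat cats1.
by rewrite /iterate foldl_rcons.
Qed.

Let measurable_hist k h : measurable (hist k @^-1` [set h]).
Proof.
have -> : hist k @^-1` [set h] = \bigcap_(l in [set: 'I_k]) (i l @^-1` [set tnth h l]).
  apply/seteqP; split => [w /= <- l _|w hw]; first by rewrite /= tnth_mktuple.
  by apply: eq_from_tnth => l; rewrite tnth_mktuple; exact: hw.
by apply: fin_bigcap_measurable => // l _; exact: (dqRK_measurable hrun).
Qed.

Let preimage_next k h j : (fun w => (hist k w, i k w)) @^-1` [set (h, j)]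
  = hist k @^-1` [set h] `&` i k @^-1` [set j].
Proof. by apply/seteqP; split => w /= => [[-> ->]|[-> ->]]. Qed.

(** The selection law in terms of histories instead of sample points. A history realised by no
    sample point has an empty event, and both sides vanish. *)
Let prob_next k h j :
  fine (P ((fun w => (hist k w, i k w)) @^-1` [set (h, j)]))
  = fine (P (hist k @^-1` [set h])) * dqRK_prob A b q0 q1 (iterate h) j.
Proof.
rewrite preimage_next.
have [[w wh]|noh] := pselect (exists w, hist k w = h); last first.
  have -> : hist k @^-1` [set h] = set0.
    by apply/seteqP; split => // w /= wh; case: noh; exists w.
  by rewrite set0I measure0 mul0r.
have := dqRK_select hrun k w j.
have -> : [set v | forall l, (l < k)%N -> i l v = i l w] = hist k @^-1` [set h].
  by apply/seteqP; split => v /=; rewrite -wh => /hist_eq.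
move=> ->; rewrite iterE wh fineM//.
by rewrite fin_num_measure.
Qed.

(* Every iterate satisfies one equation of the system: the initial one by
   assumption, the others because the last step projected onto it. *)
Lemma dqRK_expectation_le (f : 'cV[R]_n -> R) (c : R) :
    (forall j, fnorm (arow A j) = 1) ->
    (exists j, dot x0 (arow A j) = b j 0) ->
    (forall y, 0 <= f y) ->
    (forall y, (exists j, dot y (arow A j) = b j 0) ->
      \sum_j dqRK_prob A b q0 q1 y j * f (kaczmarz_step A b y j) <= c * f y) ->
  forall k, ('E_P[fun w => f (x k w)] <= (c ^+ k * f x0)%:E)%E.
Proof.
move=> hrow hx0 f0 fc k.
pose a k := \sum_(h : k.-tuple 'I_m) f (iterate h) * fine (P (hist k @^-1` [set h])).
have aE l : ('E_P[fun w => f (x l w)])%E = (a l)%:E.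
  rewrite /a -(@expectation_finite_valued _ _ _ P _ (hist l) (f \o iterate))//=.
  by congr (expectation _ _); apply/funext => w; rewrite iterE.
have iter_eqn h : exists j, dot (iterate h) (arow A j) = b j 0.
  elim/last_ind: h => // h j _; exists j.
  rewrite /iterate foldl_rcons /kaczmarz_step dotDl dotZl dot_fnorm hrow expr1n divr1 mulr1.
  by rewrite addrC subrK.
have a_ge0 l : 0 <= a l.
  by apply: sumr_ge0 => h _; rewrite mulr_ge0// fine_ge0.
have a_next l : a l.+1 <= c * a l.
  (* Total expectation: sum over pairs of a history and the next index, then factor the probability
     of each pair. *)
  have -> : a l.+1 = \sum_(h : l.-tuple 'I_m) fine (P (hist l @^-1` [set h])) *
      \sum_j dqRK_prob A b q0 q1 (iterate h) j * f (kaczmarz_step A b (iterate h) j).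
    apply: EFin_inj; rewrite -aE.
    pose H w := (hist l w, i l w).
    pose g (hj : l.-tuple 'I_m * 'I_m) := f (kaczmarz_step A b (iterate hj.1) hj.2).
    transitivity ('E_P[fun w => g (H w)])%E.
      by congr (expectation _ _); apply/funext => w; rewrite (dqRK_next hrun) iterE.
    rewrite (@expectation_finite_valued _ _ _ P _ H g); last 2 first.
    - move=> [h j]; rewrite preimage_next; apply: measurableI => //.
      exact: (dqRK_measurable hrun).
    - by move=> hj; exact: f0.
    congr EFin; under [RHS]eq_bigr => h _ do rewrite mulr_sumr.
    rewrite pair_big; apply: eq_bigr => -[h j] _ /=.
    by rewrite prob_next /g/= mulrC mulrA.
  rewrite mulr_sumr ler_sum// => h _.
  by rewrite mulrC mulrA ler_wpM2r ?fine_ge0 ?fc.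
rewrite aE lee_fin.
suff -> : f x0 = a 0%N by exact: le_geometric.
apply: EFin_inj; rewrite -aE -[LHS](expectation_cst P); congr (expectation _ _).
by apply/funext => w; rewrite (dqRK_init hrun).
Qed.

End Run.

Theorem theorem2 (R : realType) (m n : nat) (A : 'M[R]_(m, n))
  (hrow : forall j : 'I_m, fnorm (arow A j) = 1)
  (hmn : (n < m)%N)
  (hrank : \rank A = n)
  (bt be b : 'cV[R]_m) (xs : 'cV[R]_n)
  (hxs : A *m xs = bt)
  (hb : b = bt + be)
  (beta q0 q1 : R)
  (hbeta : 0 <= beta)
  (hbe : (norm0 be)%:R <= beta * m%:R)
  (hbetam : beta * m%:R \is a Num.int)
  (hq0m : q0 * m%:R \is a Num.int)
  (hq1m : q1 * m%:R \is a Num.int)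
  (hbeta_q0 : beta < q0) (hq0_q1 : q0 < q1) (hq1_beta : q1 < 1 - beta)
  (hgap : beta < q1 - q0)
  (hcond : q1 / (q1 - q0 - beta)
             * (2 * Num.sqrt beta / Num.sqrt (1 - q1 - beta)
                + beta / (1 - q1 - beta))
           < 1 / sigma_max A ^+ 2
             * (sigma_min (q1 - beta) A ^+ 2
                + sigma_min (q0 - beta) A ^+ 2 / (q0 * m%:R)))
  (x0 : 'cV[R]_n)
  (hx0 : exists i : 'I_m, dot x0 (arow A i) = b i 0)
  (d : measure_display) (T : measurableType d) (P : probability T R)
  (i : nat -> T -> 'I_m) (x : nat -> T -> 'cV[R]_n)
  (hrun : is_dqRK A b q0 q1 x0 P i x) (k : nat) :
  let C := (q1 - q0 - beta)
             * (sigma_min (q1 - beta) A ^+ 2 / ((q1 - q0) * q1 * m%:R)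
                + sigma_min (q0 - beta) A ^+ 2
                    / ((q1 - q0) * q0 * q1 * m%:R ^+ 2))
           - sigma_max A ^+ 2 / ((q1 - q0) * m%:R)
             * (2 * Num.sqrt beta / Num.sqrt (1 - q1 - beta)
                + beta / (1 - q1 - beta)) in
  ('E_P[fun w => (fnorm (x k w - xs) ^+ 2)%R]
     <= ((1 - C) ^+ k * fnorm (x0 - xs) ^+ 2)%:E)%E.
Proof.
(* The function is the squared distance to [xs], and [1 - C] is the contraction factor of
   [one_step]. *)
apply: (@dqRK_expectation_le R m n A b q0 q1 x0 d T P i x hrun
  (fun y => fnorm (y - xs) ^+ 2) (1 - dqRK_rate A beta q0 q1)) => //.
  by move=> y; exact: sqr_ge0.
move=> y hy; apply: (one_step hrow (be := be)) => //.
by rewrite hb hxs.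
Qed.
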